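(* The logics ${\bf ITL}^0$, ${\bf ITL}^{\bf FS}$, ${\bf ITL}^{\bf CD}$ and ${\bf ITL}^{1}$ are pairwise distinct (as sets of formulas), and so are ${\bf ITL}^0_\Box$, ${\bf ITL}^{\bf FS}_\Box$, ${\bf ITL}^{\bf CD}_\Box$ and ${\bf ITL}^{1}_\Box$.
   Context: Fix a countably infinite set $\mathbb P$ of propositional variables. The language $\mathcal L$ is given by $\varphi ::= \bot \mid p \mid \varphi\wedge\varphi \mid \varphi\vee\varphi\mid \varphi\to\varphi\mid \circ\varphi\mid\Diamond\varphi\mid\Box\varphi$ with $p\in\mathbb P$; $\neg\varphi$ abbreviates $\varphi\to\bot$, $\varphi\leftrightarrow\psi$ abbreviates $(\varphi\to\psi)\wedge(\psi\to\varphi)$; $\mathcal L_\Box$ is the sublanguage without $\Diamond$. ${\bf ITL}^0$ is the least set of $\mathcal L$-formulas containing all ($\mathcal L$-instances of) intuitionistic propositional tautologies and all instances of $\neg\circ\bot$; $\circ(\varphi\wedge\psi)\leftrightarrow(\circ\varphi\wedge\circ\psi)$; $\circ(\varphi\vee\psi)\leftrightarrow(\circ\varphi\vee\circ\psi)$; $\circ(\varphi\to\psi)\to(\circ\varphi\to\circ\psi)$; $\Box(\varphi\to\psi)\to(\Box\varphi\to\Box\psi)$; $\Box(\varphi\to\psi)\to(\Diamond\varphi\to\Diamond\psi)$; $\Diamond(\varphi\vee\psi)\to(\Diamond\varphi\vee\Diamond\psi)$; $\Box\varphi\to\varphi\wedge\circ\Box\varphi$; $\varphi\vee\circ\Diamond\varphi\to\Diamond\varphi$;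 closed under the rules: from $\varphi\to\circ\varphi$ infer $\varphi\to\Box\varphi$; from $\circ\varphi\to\varphi$ infer $\Diamond\varphi\to\varphi$; modus ponens; from $\varphi$ infer $\circ\varphi$. Further schemes: ${\rm FS}_\circ(\varphi,\psi)=(\circ\varphi\to\circ\psi)\to\circ(\varphi\to\psi)$, ${\rm FS}_\Diamond(\varphi,\psi)=(\Diamond\varphi\to\Box\psi)\to\Box(\varphi\to\psi)$, ${\rm CD}(\varphi,\psi)=\Box(\varphi\vee\psi)\to\Box\varphi\vee\Diamond\psi$, ${\rm BI}(\varphi,\psi)=\Box(\varphi\vee\psi)\wedge\Box(\circ\psi\to\psi)\to\Box\varphi\vee\psi$. ${\bf ITL}^{\bf FS}$ is defined as ${\bf ITL}^0$ with the additional axiom schemes ${\rm FS}_\circ$ and ${\rm FS}_\Diamond$; ${\bf ITL}^{\bf CD}$ as ${\bf ITL}^0$ with the additional scheme ${\rm CD}$; ${\bf ITL}^1$ as ${\bf ITL}^0$ with ${\rm FS}_\circ$, ${\rm FS}_\Diamond$ and ${\rm CD}$. For each such logic $\Lambda$, $\Lambda_\Box$ is obtained by restricting all axioms and rules of $\Lambda$ to $\mathcal L_\Box$-formulas, except that when ${\rm CD}$ is an axiom of $\Lambda$, the scheme ${\rm BI}$ is added to $\Lambda_\Box$. *)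

(* Defs.v *)
From Stdlib Require Import List Ensembles.
Import ListNotations.

(* The countably infinite set of propositional variables is [nat]. *)

Declare Scope form_scope.
Delimit Scope form_scope with form.

Inductive form : Type :=
| Bot : form
| Var : nat -> form
| And : form -> form -> form
| Or : form -> form -> form
| Imp : form -> form -> form
| Next : form -> form
| Dia : form -> form
| Box : form -> form.

Bind Scope form_scope with form.
Local Open Scope form_scope.

Notation "⊥" := Bot : form_scope.
Notation "○ a" := (Next a) (at level 35, right associativity) : form_scope.
Notation "◇ a" := (Dia a) (at level 35, right associativity) : form_scope.
Notation "□ a" := (Box a) (at level 35, right associativity) : form_scope.
Notation "a ∧ b" := (And a b) (at level 40, left associativity) : form_scope.
Notation "a ∨ b" := (Or a b) (at level 50, left associativity) : form_scope.
Notation "a ⇒ b" := (Imp a b) (at level 60, right associativity) : form_scope.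

Definition Neg (a : form) : form := (a ⇒ ⊥).
Definition Iff (a b : form) : form := ((a ⇒ b) ∧ (b ⇒ a)).

Notation "¬ a" := (Neg a) (at level 35, right associativity) : form_scope.
Notation "a ⇔ b" := (Iff a b) (at level 65, no associativity) : form_scope.

Definition L_full : Ensemble form := Full_set form.

Fixpoint L_Box (a : form) : Prop :=
  match a with
  | Bot | Var _ => True
  | And a b | Or a b | Imp a b => L_Box a /\ L_Box b
  | Next a | Box a => L_Box a
  | Dia _ => False
  end.

Inductive pform : Type :=
| PBot : pform
| PVar : nat -> pform
| PAnd : pform -> pform -> pform
| POr : pform -> pform -> pform
| PImp : pform -> pform -> pform.

(* Natural deduction for intuitionistic propositional logic. *)
Inductive IPC : list pform -> pform -> Prop :=
| IPC_hyp G a : List.In a G -> IPC G a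
| IPC_botE G a : IPC G PBot -> IPC G a
| IPC_andI G a b : IPC G a -> IPC G b -> IPC G (PAnd a b)
| IPC_andE1 G a b : IPC G (PAnd a b) -> IPC G a
| IPC_andE2 G a b : IPC G (PAnd a b) -> IPC G b
| IPC_orI1 G a b : IPC G a -> IPC G (POr a b)
| IPC_orI2 G a b : IPC G b -> IPC G (POr a b)
| IPC_orE G a b c :
    IPC G (POr a b) -> IPC (a :: G) c -> IPC (b :: G) c -> IPC G c
| IPC_impI G a b : IPC (a :: G) b -> IPC G (PImp a b)
| IPC_impE G a b : IPC G (PImp a b) -> IPC G a -> IPC G b.

Fixpoint subst (s : nat -> form) (t : pform) : form :=
  match t with
  | PBot => Bot
  | PVar n => s n
  | PAnd t u => And (subst s t) (subst s u)
  | POr t u => Or (subst s t) (subst s u)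
  | PImp t u => Imp (subst s t) (subst s u)
  end.

Inductive Ax0 : Ensemble form :=
| Ax0_taut (t : pform) (s : nat -> form) : IPC [] t -> Ax0 (subst s t)
| Ax0_next_bot : Ax0 (¬ ○ ⊥)
| Ax0_next_and a b : Ax0 (○ (a ∧ b) ⇔ (○ a ∧ ○ b))
| Ax0_next_or a b : Ax0 (○ (a ∨ b) ⇔ (○ a ∨ ○ b))
| Ax0_next_imp a b : Ax0 (○ (a ⇒ b) ⇒ (○ a ⇒ ○ b))
| Ax0_box_imp a b : Ax0 (□ (a ⇒ b) ⇒ (□ a ⇒ □ b))
| Ax0_dia_imp a b : Ax0 (□ (a ⇒ b) ⇒ (◇ a ⇒ ◇ b))
| Ax0_dia_or a b : Ax0 (◇ (a ∨ b) ⇒ (◇ a ∨ ◇ b))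
| Ax0_box_fix a : Ax0 (□ a ⇒ (a ∧ ○ □ a))
| Ax0_dia_fix a : Ax0 ((a ∨ ○ ◇ a) ⇒ ◇ a).

Inductive FS_next : Ensemble form :=
| FS_next_intro a b : FS_next ((○ a ⇒ ○ b) ⇒ ○ (a ⇒ b)).

Inductive FS_dia : Ensemble form :=
| FS_dia_intro a b : FS_dia ((◇ a ⇒ □ b) ⇒ □ (a ⇒ b)).

Inductive CD : Ensemble form :=
| CD_intro a b : CD (□ (a ∨ b) ⇒ (□ a ∨ ◇ b)).

Inductive BI : Ensemble form :=
| BI_intro a b : BI ((□ (a ∨ b) ∧ □ (○ b ⇒ b)) ⇒ (□ a ∨ b)).

(* [logic L Ax]: the least set containing the axioms [Ax] and closed under the
   rules, where only instances of axioms and rules all of whose formulas lie in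
   the language [L] are allowed.  With [L := L_Box] this discards every axiom
   instance containing [◇] (in particular all of [FS_dia] and [CD]) and the
   induction rule for [◇]. *)
Inductive logic (L Ax : Ensemble form) : Ensemble form :=
| logic_ax a : L a -> Ax a -> logic L Ax a
| logic_mp a b :
    L a -> L (a ⇒ b) -> L b ->
    logic L Ax a -> logic L Ax (a ⇒ b) -> logic L Ax b
| logic_nec a : L a -> L (○ a) -> logic L Ax a -> logic L Ax (○ a)
| logic_box_ind a :
    L (a ⇒ ○ a) -> L (a ⇒ □ a) ->
    logic L Ax (a ⇒ ○ a) -> logic L Ax (a ⇒ □ a)
| logic_dia_ind a :
    L (○ a ⇒ a) -> L (◇ a ⇒ a) ->
    logic L Ax (○ a ⇒ a) -> logic L Ax (◇ a ⇒ a).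

Notation "A ∪ B" := (Union form A B) (at level 50, left associativity).

Definition ITL0 : Ensemble form := logic L_full Ax0.
Definition ITLFS : Ensemble form := logic L_full (Ax0 ∪ FS_next ∪ FS_dia).
Definition ITLCD : Ensemble form := logic L_full (Ax0 ∪ CD).
Definition ITL1 : Ensemble form := logic L_full (Ax0 ∪ FS_next ∪ FS_dia ∪ CD).

Definition ITL0_Box : Ensemble form := logic L_Box Ax0.
Definition ITLFS_Box : Ensemble form := logic L_Box (Ax0 ∪ FS_next ∪ FS_dia).
Definition ITLCD_Box : Ensemble form := logic L_Box (Ax0 ∪ CD ∪ BI).
Definition ITL1_Box : Ensemble form :=
  logic L_Box (Ax0 ∪ FS_next ∪ FS_dia ∪ CD ∪ BI).

Definition pairwise_distinct (l : list (Ensemble form)) : Prop :=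
  ForallOrdPairs (fun A B => ~ Same_set form A B) l.

(* Main.v *)
Require Import Defs.
From Stdlib Require Import List Ensembles.
Import ListNotations.
From Stdlib Require Import ZArith Lia Classical.

(** All the logics are interpreted in dynamic topological systems, where an
    implication holds at a point if it holds pointwise on a neighbourhood, and
    [□ a] denotes the largest open forward-invariant subset of [a].  Every system
    validates ITL0; open maps validate both FS schemes; Alexandrov topologies
    validate CD and BI.  A three-point poset with a monotone map that is not open
    refutes FS for [○].  Dually, CD and BI fail for the homeomorphism [n ↦ n+1] of
    the space consisting of the discrete points of Z together with a limit
    point at minus infinity, which is fixed. *)

Record system : Type := {
  point :> Type;
  open : (point -> Prop) -> Prop;
  open_full : open (fun _ => True);
  open_inter U V : open U -> open V -> open (fun x => U x /\ V x);
  (* This form of closure under unions also makes the empty set open and lets openness pass between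
     pointwise equivalent predicates without extensionality axioms. *)
  open_local U :
    (forall x, U x -> exists V, open V /\ V x /\ forall y, V y -> U y) -> open U;
  step : point -> point;
  step_continuous U : open U -> open (fun x => U (step x))
}.
Arguments open {_}.
Arguments step {_}.

(** * Topological semantics and soundness of the base logic *)

Section Soundness.
Context (M : system) (val : nat -> M -> Prop).

Definition orbit (n : nat) (x : M) : M := Nat.iter n step x.

Lemma orbit_step n x : orbit n (step x) = step (orbit n x).
Proof. symmetry; apply Nat.iter_succ_r. Qed.

(** Only [Imp] and [Box] need an explicit neighbourhood for truth sets to be open; [Dia] yields a
    union of preimages under continuous iterates. *)
Fixpoint forces (a : form) : M -> Prop :=
  match a with
  | Bot => fun _ => False
  | Var n => val n
  | And a b => fun x => forces a x /\ forces b x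
  | Or a b => fun x => forces a x \/ forces b x
  | Imp a b => fun x =>
      exists U, open U /\ U x /\ forall y, U y -> forces a y -> forces b y
  | Next a => fun x => forces a (step x)
  | Dia a => fun x => exists n, forces a (orbit n x)
  | Box a => fun x =>
      exists U, open U /\ U x /\ forall y, U y -> U (step y) /\ forces a y
  end.

Definition valid (a : form) : Prop := forall x, forces a x.

Lemma open_orbit n U : open U -> open (fun x : M => U (orbit n x)).
Proof.
  revert U; induction n as [|n IH]; intros U HU; [exact HU|].
  exact (IH _ (step_continuous M U HU)).
Qed.

Lemma invariant_orbit (U : M -> Prop) n x :
  (forall y, U y -> U (step y)) -> U x -> U (orbit n x).
Proof. intros HU Hx; induction n; simpl; auto. Qed.

Lemma forces_imp_elim a b x : forces (Imp a b) x -> forces a x -> forces b x.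
Proof. intros (U & _ & Ux & H); auto. Qed.

Lemma valid_imp a b : (forall x, forces a x -> forces b x) -> valid (Imp a b).
Proof.
  intros H x; exists (fun _ => True).
  split; [apply open_full | split; auto].
Qed.

Hypothesis val_open : forall n, open (val n).

Lemma forces_open a : open (forces a).
Proof.
  induction a as [|n|a IHa b IHb|a IHa b IHb|a IHa b IHb|a IHa|a IHa|a IHa]; simpl.
  - apply open_local; tauto.
  - apply val_open.
  - apply open_inter; assumption.
  - apply open_local; intros x [H|H]; [exists (forces a)|exists (forces b)]; auto.
  - apply open_local; intros x (U & HU & Ux & H).
    exists U; repeat split; auto. intros y Uy; exists U; auto.
  - apply step_continuous; assumption.
  - apply open_local; intros x [n H].
    exists (fun y => forces a (orbit n y)).
    repeat split; [apply open_orbit; assumption | assumption | eauto].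
  - apply open_local; intros x (U & HU & Ux & H).
    exists U; repeat split; auto. intros y Uy; exists U; auto.
Qed.

Lemma IPC_sound s G t : IPC G t ->
  forall x, Forall (fun g => forces (subst s g) x) G -> forces (subst s t) x.
Proof.
  (* In the case [IPC_impI] the truth set of the context serves as the neighbourhood. *)
  assert (ctx_open : forall G, open (fun x : M => Forall (fun g => forces (subst s g) x) G)).
  { induction G0 as [|g G0 IH]; apply open_local; intros x Hx.
    - exists (fun _ => True); repeat split; auto using open_full.
    - exists (fun y => forces (subst s g) y /\ Forall (fun g => forces (subst s g) y) G0).
      inversion Hx; subst; repeat split; auto.
      + apply (open_inter M); [apply forces_open | exact IH].
      + intros y [? ?]; constructor; auto. }
  induction 1; intros x HG; cbn [subst forces] in *.
  - rewrite Forall_forall in HG; auto.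
  - destruct (IHIPC x HG).
  - auto.
  - apply IHIPC, HG.
  - apply IHIPC, HG.
  - left; auto.
  - right; auto.
  - destruct (IHIPC1 x HG); auto.
  - exists (fun x => Forall (fun g => forces (subst s g) x) G); auto.
  - eapply forces_imp_elim; [exact (IHIPC1 x HG) | auto].
Qed.

Lemma Ax0_valid a : Ax0 a -> valid a.
Proof.
  intros [t s Ht| | b c | b c | b c | b c | b c | b c | b | b].
  - intros x; exact (IPC_sound s [] t Ht x (Forall_nil _)).
  - apply valid_imp; simpl; auto.
  - intros x; split; apply valid_imp; simpl; auto.
  - intros x; split; apply valid_imp; simpl; auto.
  - apply valid_imp; simpl; intros x (U & HU & Ux & H).
    exists (fun y => U (step y)); auto using step_continuous.
  - apply valid_imp; intros x (U & HU & Ux & H).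
    exists U; repeat split; auto; intros y Uy (V & HV & Vy & K).
    exists (fun z => U z /\ V z); repeat split; auto using open_inter.
    + apply H; tauto.
    + apply K; tauto.
    + eapply forces_imp_elim; [apply H | apply K]; tauto.
  - apply valid_imp; intros x (U & HU & Ux & H).
    exists U; repeat split; auto; intros y Uy [n Hn].
    exists n; eapply forces_imp_elim; [apply H | exact Hn].
    apply invariant_orbit; auto; apply H.
  - apply valid_imp; intros x [n [H|H]]; [left|right]; exists n; auto.
  - apply valid_imp; intros x (U & HU & Ux & H); split; [apply H; auto|].
    exists U; repeat split; auto; apply H; auto.
  - apply valid_imp; intros x [H|[n H]]; [exists 0; auto|].
    exists (S n); simpl; rewrite <- orbit_step; exact H.
Qed.

Lemma logic_valid L Ax a :
  (forall b, Ax b -> valid b) -> logic L Ax a -> valid a.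
Proof.
  intros HAx; induction 1 as [a _ H|a b _ _ _ _ IH1 _ IH2|a _ _ _ IH|a _ _ _ IH|a _ _ _ IH].
  - auto.
  - intros x; exact (forces_imp_elim _ _ x (IH2 x) (IH1 x)).
  - intros x; apply IH.
  (* By the premise, the truth set of [a] is itself open and forward-invariant. *)
  - apply valid_imp; intros x Hx; exists (forces a).
    split; [apply forces_open; assumption | split; [assumption|]].
    intros y Hy; split; [exact (forces_imp_elim a (Next a) y (IH y) Hy) | exact Hy].
  - apply valid_imp; intros x [n Hn]; induction n as [|n IHn]; auto.
    apply IHn, (forces_imp_elim (Next a) a _ (IH _)), Hn.
Qed.

(** * Open maps and the FS schemes *)

Section OpenMap.
Hypothesis step_open :
  forall U, open U -> open (fun y : M => exists x, U x /\ step x = y).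

Lemma orbit_open n U : open U -> open (fun y : M => exists x, U x /\ orbit n x = y).
Proof.
  intros HU; induction n as [|n IH]; apply open_local.
  - intros _ (x & Ux & <-); exists U; repeat split; simpl; eauto.
  - intros y (x & Ux & Hy). exists (fun y => exists z, (exists x, U x /\ orbit n x = z) /\ step z = y).
    repeat split; eauto.
    intros y' (z & (x' & Ux' & <-) & Hy'); eauto.
Qed.

Lemma FS_next_valid a : FS_next a -> valid a.
Proof.
  intros [b c]; apply valid_imp; intros x (U & HU & Ux & H).
  exists (fun y => exists x, U x /\ step x = y); repeat split; eauto.
  intros _ (z & Uz & <-); apply H; auto.
Qed.

(** The forward orbit of [U] is open, as a union of images, and invariant. If [b] holds at a point
    [orbit n z] of it, then [◇ b] and hence [□ c] hold at [z], and invariance carries [c] to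
    [orbit n z]. *)
Lemma FS_dia_valid a : FS_dia a -> valid a.
Proof.
  intros [b c]; apply valid_imp; intros x (U & HU & Ux & H).
  exists (fun y => exists n z, U z /\ orbit n z = y).
  split; [|split; [exists 0, x; auto | intros y (n & Hy); split]].
  - apply open_local; intros y (n & Hy).
    exists (fun y => exists z, U z /\ orbit n z = y); eauto using orbit_open.
  - destruct Hy as (z & Uz & <-); exists (S n), z; auto.
  - exists (fun y => exists z, U z /\ orbit n z = y); repeat split; auto using orbit_open.
    intros _ (z & Uz & <-) Hb.
    destruct (H z Uz (ex_intro _ n Hb)) as (V & HV & Vz & K).
    apply K, invariant_orbit; auto; apply K.
Qed.

End OpenMap.

(** * Alexandrov topologies, CD and BI *)

Section Alexandrov.
Hypothesis open_bigcap :
  forall F : nat -> M -> Prop, (forall n, open (F n)) -> open (fun x => forall n, F n x).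

(** Classically, either [a] holds along the whole orbit or [b] holds where [a] first seen to fail.
    In the former case the points whose orbits stay in [a] form a countable intersection of open
    sets, which is open and invariant. *)
Lemma box_or_split a b x :
  forces (Box (Or a b)) x -> forces (Box a) x \/ forces (Dia b) x.
Proof.
  intros (U & HU & Ux & H).
  destruct (classic (forall n, forces a (orbit n x))) as [Ha|Ha]; [left|right].
  - exists (fun y => forall n, forces a (orbit n y)); split; [|split; [exact Ha|]].
    + apply open_bigcap; intros n; apply open_orbit, forces_open.
    + intros y Hy; split; [|exact (Hy 0)].
      intros n; rewrite orbit_step; apply (Hy (S n)).
  - apply not_all_ex_not in Ha; destruct Ha as [n Hn]; exists n.
    destruct (H (orbit n x)) as [_ [?|?]]; try tauto.
    apply invariant_orbit; auto; apply H.
Qed.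

Lemma CD_valid a : CD a -> valid a.
Proof. intros [b c]; apply valid_imp, box_or_split. Qed.

Lemma BI_valid a : BI a -> valid a.
Proof.
  intros [b c]; apply valid_imp; intros x [Hor (U & HU & Ux & H)].
  destruct (box_or_split _ _ _ Hor) as [?|[n Hn]]; [left; auto | right].
  (* [□ (○ c ⇒ c)] pulls [c] back along the orbit, one point at a time. *)
  induction n as [|n IH]; auto.
  apply IH, (forces_imp_elim (Next c) c); auto.
  apply H, invariant_orbit; auto; apply H.
Qed.

End Alexandrov.
End Soundness.

(** * A poset refuting FS for [○] *)

(* The order is generated by [mid <= top]; opens are the up-sets. *)
Inductive three := source | mid | top.

Definition three_step (x : three) : three :=
  match x with top => top | _ => mid end.

Definition poset_system : system.
Proof.
  refine {| point := three; open := fun U => U mid -> U top; step := three_step |}.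
  - auto.
  - tauto.
  - intros U H Hm; destruct (H mid Hm) as (V & HV & Vm & HVU); auto.
  - auto.
Defined.

Definition poset_val (_ : nat) (x : poset_system) : Prop := x = top.

Lemma poset_val_open n : open (poset_val n).
Proof. intros _; reflexivity. Qed.

Lemma poset_open_bigcap (F : nat -> poset_system -> Prop) :
  (forall n, open (F n)) -> open (fun x => forall n, F n x).
Proof. intros HF H n; apply HF, H. Qed.

Definition fs_instance : form :=
  ((○ Var 0 ⇒ ○ ⊥) ⇒ ○ (Var 0 ⇒ ⊥))%form.

(** At [source] the premise holds vacuously on the open set of [source] alone, since its image [mid]
    is not [top]. Every open set around [mid] contains [top], so the conclusion fails. *)
Lemma poset_refutes_FS : ~ valid poset_system poset_val fs_instance.
Proof.
  intros H.
  destruct (forces_imp_elim poset_system _ _ _ source (H source)) as (U & HU & Um & K).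
  - exists (fun x => x = source); repeat split.
    + discriminate.
    + intros y -> Hy; discriminate Hy.
  - exact (K top (HU Um) eq_refl).
Qed.

(** * A homeomorphism refuting CD and BI *)

(* [None] is the point at minus infinity. *)
Definition Zinf_system : system.
Proof.
  refine {| point := option Z;
            open := fun U =>
              U None -> exists N, forall n, (n <= N)%Z -> U (Some n);
            step := option_map Z.succ |}.
  - exists 0%Z; auto.
  - intros U V HU HV [HUn HVn].
    destruct (HU HUn) as [N HN], (HV HVn) as [K HK].
    exists (Z.min N K); intros n Hn; split; [apply HN|apply HK]; lia.
  - intros U H Hn; destruct (H None Hn) as (V & HV & Vn & HVU).
    destruct (HV Vn) as [N HN]; exists N; auto.
  - intros U HU Hn; destruct (HU Hn) as [N HN].
    exists (Z.pred N); intros n Hle; apply HN; lia.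
Defined.

Lemma Zinf_step_open (U : Zinf_system -> Prop) :
  open U -> open (fun y => exists x, U x /\ step x = y).
Proof.
  intros HU ([x|] & Ux & Hx); [discriminate|].
  destruct (HU Ux) as [N HN]; exists N; intros n Hn.
  exists (Some (Z.pred n)); split; [apply HN; lia|].
  simpl; f_equal; lia.
Qed.

(** Variable 0 holds on a neighbourhood of [None] that every integer orbit leaves; variable 1 holds
    exactly off the fixed point. *)
Definition Zinf_val (i : nat) (x : Zinf_system) : Prop :=
  match i, x with
  | 0, Some n => (n <= 0)%Z
  | 0, None => True
  | _, Some _ => True
  | _, None => False
  end.

Lemma Zinf_val_open i : open (Zinf_val i).
Proof. destruct i; [intros _; exists 0%Z; auto | intros []]. Qed.

Lemma Zinf_box_or : forces Zinf_system Zinf_val (Box (Or (Var 0) (Var 1))) None.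
Proof.
  exists (fun _ => True); repeat split; [exists 0%Z; auto|].
  destruct y; [right | left]; exact I.
Qed.

Lemma Zinf_not_box : ~ forces Zinf_system Zinf_val (Box (Var 0)) None.
Proof.
  intros (U & HU & Un & H).
  destruct (HU Un) as [N HN].
  assert (K : forall k : nat, U (Some (N + Z.of_nat k)%Z)).
  { induction k as [|k IH]; [apply HN; lia|].
    destruct (H _ IH) as [Hs _]; simpl in Hs.
    replace (N + Z.of_nat (S k))%Z with (Z.succ (N + Z.of_nat k)) by lia; exact Hs. }
  (* This index reaches the integer max(N, 1), where variable 0 fails. *)
  destruct (H _ (K (Z.to_nat (1 - N)))) as [_ Hle]; cbn [forces Zinf_val] in Hle; lia.
Qed.

Definition cd_instance : form :=
  (□ (Var 0 ∨ Var 1) ⇒ (□ Var 0 ∨ ◇ Var 1))%form.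

Definition bi_instance : form :=
  ((□ (Var 0 ∨ Var 1) ∧ □ (○ Var 1 ⇒ Var 1)) ⇒ (□ Var 0 ∨ Var 1))%form.

Lemma Zinf_refutes_CD : ~ valid Zinf_system Zinf_val cd_instance.
Proof.
  intros H.
  destruct (forces_imp_elim Zinf_system _ _ _ None (H None) Zinf_box_or) as [K|[n K]].
  - exact (Zinf_not_box K).
  - assert (E : orbit Zinf_system n None = None)
      by (apply (invariant_orbit Zinf_system (fun x => x = None)); [now intros y -> | reflexivity]).
    rewrite E in K; exact K.
Qed.

Lemma Zinf_refutes_BI : ~ valid Zinf_system Zinf_val bi_instance.
Proof.
  intros H.
  destruct (forces_imp_elim Zinf_system _ _ _ None (H None)) as [K|K].
  - split; [exact Zinf_box_or|].
    exists (fun _ => True); repeat split; [exists 0%Z; auto|].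
    (* [step] sends [None] to itself, so variable 1 is already false there under [○]. *)
    apply valid_imp; intros [n|]; simpl; auto.
  - exact (Zinf_not_box K).
  - exact K.
Qed.

(** * Separation *)

(** Bounding the axioms from above treats all four logics without FS at once, in both languages. *)
Lemma not_in_CD_BI L Ax :
  Included form Ax (Ax0 ∪ CD ∪ BI) -> ~ logic L Ax fs_instance.
Proof.
  intros HAx H; apply poset_refutes_FS, (logic_valid _ _ poset_val_open L Ax); auto.
  intros b Hb; destruct (HAx b Hb) as [c [d Hd|d Hd]|c Hc];
    eauto using Ax0_valid, CD_valid, BI_valid, poset_val_open, poset_open_bigcap.
Qed.

Lemma FS_valid_Zinf L Ax a :
  Included form Ax (Ax0 ∪ FS_next ∪ FS_dia) -> logic L Ax a ->
  valid Zinf_system Zinf_val a.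
Proof.
  intros HAx; apply (logic_valid _ _ Zinf_val_open).
  intros b Hb; destruct (HAx b Hb) as [c [d Hd|d Hd]|c Hc];
    eauto using Ax0_valid, FS_next_valid, FS_dia_valid, Zinf_val_open, Zinf_step_open.
Qed.

(** The four sets have four different membership patterns on [X] and [Y]. *)
Lemma pairwise_distinct_4 (A B C D : Ensemble form) X Y :
  B X -> D X -> C Y -> D Y -> ~ A X -> ~ C X -> ~ A Y -> ~ B Y ->
  pairwise_distinct [A; B; C; D].
Proof.
  intros; repeat apply FOP_cons; try apply FOP_nil;
    repeat apply Forall_cons; try apply Forall_nil; intros [I J];
    unfold Included, In in I, J; auto.
Qed.

Lemma union_l (A B : Ensemble form) a : A a -> (A ∪ B) a.
Proof. exact (Union_introl form A B a). Qed.

Lemma union_r (A B : Ensemble form) a : B a -> (A ∪ B) a.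
Proof. exact (Union_intror form A B a). Qed.

Theorem theorem6p5 :
  pairwise_distinct [ITL0; ITLFS; ITLCD; ITL1] /\
  pairwise_distinct [ITL0_Box; ITLFS_Box; ITLCD_Box; ITL1_Box].
Proof.
  split.
  - apply pairwise_distinct_4 with (X := fs_instance) (Y := cd_instance).
    1-4: apply logic_ax; [constructor | unfold fs_instance, cd_instance;
      auto 6 using union_l, union_r, FS_next_intro, CD_intro].
    1,2: apply not_in_CD_BI; intros b Hb; unfold In in *; auto using union_l.
    1,2: intros H; apply Zinf_refutes_CD; revert H; apply FS_valid_Zinf;
      intros b Hb; unfold In in *; auto using union_l.
  (* [cd_instance] contains [◇], so an instance of BI replaces it in the [◇]-free language. *)
  - apply pairwise_distinct_4 with (X := fs_instance) (Y := bi_instance).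
    1-4: apply logic_ax; [cbv; tauto | unfold fs_instance, bi_instance;
      auto 7 using union_l, union_r, FS_next_intro, BI_intro].
    1,2: apply not_in_CD_BI; intros b Hb; unfold In in *; auto using union_l.
    1,2: intros H; apply Zinf_refutes_BI; revert H; apply FS_valid_Zinf;
      intros b Hb; unfold In in *; auto using union_l.
Qed.
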